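(* Let $\{\Omega_p\}_{p\ge0}$ be a chain complex of finite-dimensional real vector spaces, each $\Omega_p$ equipped with an arbitrary inner product. Then, for all $p\ge0$, $$\operatorname{spec}_+\Delta_p=\operatorname{spec}_+\mathcal K_p\sqcup\operatorname{spec}_+\mathcal L_p$$ and $$\operatorname{spec}_+\mathcal K_p=\operatorname{spec}_+\mathcal L_{p+1}.$$ Consequently, $$\operatorname{spec}_+\Delta_p=\operatorname{spec}_+\mathcal L_p\sqcup\operatorname{spec}_+\mathcal L_{p+1}.$$
   Context: The chain complex is $0\leftarrow\Omega_0\xleftarrow{\partial}\Omega_1\xleftarrow{\partial}\cdots\xleftarrow{\partial}\Omega_{p-1}\xleftarrow{\partial}\Omega_p\xleftarrow{\partial}\cdots$ with linear maps $\partial:\Omega_p\to\Omega_{p-1}$, $\partial^2=0$ (and $\partial=0$ on $\Omega_0$). $\partial^*:\Omega_{p-1}\to\Omega_p$ is the adjoint of $\partial:\Omega_p\to\Omega_{p-1}$ with respect to the given inner products. Define the self-adjoint non-negative definite operators on $\Omega_p$: $\mathcal K_p=\partial\partial^*|_{\Omega_p}$ (that is, $\Omega_p\xrightarrow{\partial^*}\Omega_{p+1}\xrightarrow{\partial}\Omega_p$), $\mathcal L_p=\partial^*\partial|_{\Omega_p}$ (that is, $\Omega_p\xrightarrow{\partial}\Omega_{p-1}\xrightarrow{\partial^*}\Omega_p$; $\mathcal L_0=0$), and the Hodge Laplacian $\Delta_p=\mathcal K_p+\mathcal L_p$. $\operatorname{spec}A$ is the multiset of eigenvalues of a self-adjoint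 operator $A$, counted with multiplicity, and $\operatorname{spec}_+A$ is obtained from $\operatorname{spec}A$ by removing all zero eigenvalues (so for non-negative definite $A$ it is the multiset of positive eigenvalues). $\sqcup$ is disjoint union of multisets (multiplicities add). *)

(* Defs.v *)
From HB Require Import structures.
From mathcomp Require Import all_boot all_order all_algebra sesquilinear.
From mathcomp Require Import finmap multiset.
From mathcomp Require Import boolp classical_sets functions cardinality reals.

Set Implicit Arguments.
Unset Strict Implicit.
Unset Printing Implicit Defensive.

Import Order.TTheory GRing.Theory Num.Theory.
Import passmx.
Local Open Scope classical_set_scope.
Local Open Scope ring_scope.

(* Over the reals an inner product is a positive definite hermitian form with
   trivial conjugation. *)
Notation inner_product U := {dot U for idfun}.

Section Adjoint.
Variables (R : realType) (U V : vectType R).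
Variables (ipU : inner_product U) (ipV : inner_product V).

Definition is_adjoint (f : 'Hom(U, V)) (g : 'Hom(V, U)) : Prop :=
  forall u v, ipV (f u) v = ipU u (g v).

(* The default value 0 is never used: see [adjointP], [adjoint_uniq]. *)
Definition adjoint (f : 'Hom(U, V)) : 'Hom(V, U) :=
  xget 0 [set g | is_adjoint f g].

End Adjoint.

Section AdjointTheory.
Variables (R : realType) (U V : vectType R).
Variables (ipU : inner_product U) (ipV : inner_product V).

Let n := \dim {:U}.
Let e : n.-tuple U := vbasis {:U}.

Definition gram_row (f : 'Hom(U, V)) (v : V) : 'rV[R]_n :=
  \row_i ipV (f e`_i) v.

Lemma gram_row_linear f : linear (gram_row f).
Proof. by move=> a u v; apply/rowP => i; rewrite !mxE linearPr. Qed.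
HB.instance Definition _ f :=
  GRing.isLinear.Build R V 'rV[R]_n _ (gram_row f) (gram_row_linear f).

Lemma dot_definite u : ipU u u = 0 -> u = 0.
Proof.
move=> h; apply: contrapT => /eqP.
by move=> /(@neq0_dnorm_gt0 _ _ _ ipU); rewrite h ltxx.
Qed.

Lemma adjoint_uniq (f : 'Hom(U, V)) (g h : 'Hom(V, U)) :
  is_adjoint ipU ipV f g -> is_adjoint ipU ipV f h -> g = h.
Proof.
move=> hg hh; apply/lfunP => v; apply/eqP; rewrite -subr_eq0; apply/eqP.
apply: dot_definite.
by rewrite (linearBr ipU) /= -hg -hh subrr.
Qed.

End AdjointTheory.

Lemma adjoint_exists (R : realType) (U V : vectType R)
    (ipU : inner_product U) (ipV : inner_product V) (f : 'Hom(U, V)) :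
  exists g, is_adjoint ipU ipV f g.
Proof.
pose phi := linfun (gram_row ipU \1%VF); pose psi := linfun (gram_row ipV f).
have expand (W : vectType R) (ip : inner_product W) (h : 'Hom(U, W)) u w :
    ip (h u) w = \sum_i coord (vbasis fullv) i u * gram_row ip h w 0 i.
  rewrite {1}(coord_vbasis (memvf u)) linear_sum linear_sumlz.
  by apply: eq_bigr => i _; rewrite linearZ /= linearZl_LR mxE.
have kphi : lker phi == 0%VS.
  apply/lker0P => u v /eqP; rewrite -subr_eq0 -linearB => /eqP h.
  apply/eqP; rewrite -subr_eq0; apply/eqP; apply: (@dot_definite _ _ ipU).
  rewrite -{1}[u - v]id_lfunE expand big1 // => i _.
  by move: h; rewrite /= lfunE /= => ->; rewrite mxE mulr0.
have iphi : limg phi = fullv.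
  apply/eqP; rewrite eqEdim subvf /= limg_dim_eq ?(eqP kphi) ?capv0 //.
  by rewrite !dimvf dim_matrix mul1r.
exists (phi^-1 \o psi)%VF => u v.
have h : phi ((phi^-1 \o psi)%VF v) = psi v.
  by rewrite comp_lfunE limg_lfunVK // iphi memvf.
rewrite expand -[X in ipU X]id_lfunE expand; apply: eq_bigr => i _.
by move: h; rewrite /phi /psi !lfunE /= => ->.
Qed.

Lemma adjointP (R : realType) (U V : vectType R)
    (ipU : inner_product U) (ipV : inner_product V) (f : 'Hom(U, V)) u v :
  ipV (f u) v = ipU u (adjoint ipU ipV f v).
Proof.
have [g hg] := adjoint_exists ipU ipV f.
exact: (@xgetPex _ 0 [set g | is_adjoint ipU ipV f g] (ex_intro _ g hg)).
Qed.

Section Spectrum.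
Variables (R : realType) (V : vectType R).
Implicit Type A : 'End(V).

(* The multiset in which each eigenvalue of A has multiplicity the dimension of
   its eigenspace; for self-adjoint A this is also its multiplicity as a root of
   the characteristic polynomial. [fset_set] is the given set because there are
   finitely many eigenvalues, see [finite_eigenvalues] and [specE]. *)
Definition spec A : {mset R}%mset :=
  [fsfun a in fset_set [set a | leigenvalue A a] => \dim (leigenspace A a)].

Definition spec_plus A : {mset R}%mset := (spec A `\` msetn (spec A 0%R) 0%R)%mset.

Lemma finite_eigenvalues A : finite_set [set a | leigenvalue A a].
Proof.
apply: contrapT => /infinite_set_fset.
pose M := mxof (vbasis {:V}) (vbasis {:V}) A.
move=> /(_ (size (char_poly M))) [B sB]; rewrite leqNgt => /negP; apply.
apply: max_poly_roots (fset_uniq B).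
  by apply: monic_neq0; apply: char_poly_monic.
apply/allP => a /sB /=; rewrite -eigenvalue_root_char /leigenvalue.
rewrite (leigenspaceE (vbasisP {:V})) vsof_eq0 //.
exact: vbasisP.
Qed.

Lemma specE A a : spec A a = \dim (leigenspace A a).
Proof.
rewrite fsfunE in_fset_set ?inE; last exact: finite_eigenvalues.
case: ifPn => //; rewrite notin_setE /= => /negP; rewrite negbK => /eqP ->.
by rewrite dimv0.
Qed.

Lemma spec_plusE A a : spec_plus A a = if a == 0 then 0%N else spec A a.
Proof.
by rewrite msetE2 msetnE; case: eqP => [->|_]; rewrite ?subnn ?subn0.
Qed.

End Spectrum.

Section Hodge.
Variables (R : realType) (Omega : nat -> vectType R).
Variable ip : forall p, inner_product (Omega p).
Variable d : forall p, 'Hom(Omega p.+1, Omega p).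

Let dstar p : 'Hom(Omega p, Omega p.+1) := adjoint (ip p.+1) (ip p) (d p).

Definition hodge_K p : 'End(Omega p) := (d p \o dstar p)%VF.

(* The boundary map on Omega 0 is zero, hence so is [hodge_L 0]. *)
Definition hodge_L p : 'End(Omega p) :=
  match p with
  | 0 => 0
  | q.+1 => (dstar q \o d q)%VF
  end.

Definition hodge_laplacian p : 'End(Omega p) := hodge_K p + hodge_L p.

End Hodge.

(* Main.v *)
Require Import Defs.
From mathcomp Require Import all_boot all_order all_algebra sesquilinear.
From mathcomp Require Import finmap multiset.
From mathcomp Require Import reals.

Set Implicit Arguments.
Unset Strict Implicit.
Unset Printing Implicit Defensive.

Import Order.TTheory GRing.Theory Num.Theory.
Import passmx.
Local Open Scope ring_scope.

(** The first two identities hold eigenvalue by eigenvalue, as identities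
    between dimensions of eigenspaces.

    Let a be a nonzero number.  For linear maps f and g in opposite directions,
    g maps the a-eigenspace of fg into that of gf, and f maps it back; the round
    trip is multiplication by a, so both maps are injective and the eigenspaces
    have equal dimension ([leigenspace_comp_dim]).  For f the boundary map and g
    its adjoint this compares the operators K of one degree with L of the next.

    In the identity for the Laplacian, K and L annihilate each other on either
    side ([hodge_KL0], [hodge_LK0]), because both the boundary and its adjoint
    square to zero.  For two such endomorphisms the a-eigenspace of the sum is
    the direct sum of their a-eigenspaces ([leigenspace_add_dim]): the
    decomposition of an eigenvector v is v = a^-1 K v + a^-1 L v.  The last
    identity then combines the first two. *)

(** * Nonzero eigenvalues of compositions and of sums *)

Section Eigenspaces.
Variable F : fieldType.
Implicit Types (U V : vectType F) (a : F).

Lemma mem_leigenspace V (A : 'End(V)) a v :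
  (v \in leigenspace A a) = (A v == a *: v).
Proof.
by rewrite memv_ker !lfunE /= !lfunE /= scale_lfunE id_lfunE subr_eq0.
Qed.

(** On the a-eigenspace of fg the map g is injective, since applying f
    afterwards multiplies by a. *)
Lemma leigenspace_comp_dim_le U V (f : 'Hom(U, V)) (g : 'Hom(V, U)) a :
  a != 0 -> (\dim (leigenspace (f \o g)%VF a)
             <= \dim (leigenspace (g \o f)%VF a))%N.
Proof.
move=> a0.
rewrite -(limg_dim_eq (f := g) (U := leigenspace (f \o g)%VF a)); last first.
  apply/eqP; rewrite -subv0; apply/subvP => v.
  rewrite memv_cap mem_leigenspace memv_ker comp_lfunE => /andP[/eqP fgv /eqP gv].
  move: fgv; rewrite gv linear0 memv0 => /esym/eqP.
  by rewrite scaler_eq0 (negPf a0).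
apply/dimvS/subvP => _ /memv_imgP[v + ->].
by rewrite !mem_leigenspace !comp_lfunE => /eqP ->; rewrite linearZ.
Qed.

Lemma leigenspace_comp_dim U V (f : 'Hom(U, V)) (g : 'Hom(V, U)) a :
  a != 0 ->
  \dim (leigenspace (f \o g)%VF a) = \dim (leigenspace (g \o f)%VF a).
Proof.
by move=> a0; apply/eqP; rewrite eqn_leq !leigenspace_comp_dim_le.
Qed.

Lemma leigenspace_subD V (A B : 'End(V)) a :
  a != 0 -> (B \o A)%VF = 0 -> (leigenspace A a <= leigenspace (A + B)%R a)%VS.
Proof.
move=> a0 BA0; apply/subvP => v; rewrite !mem_leigenspace add_lfunE => /eqP Av.
have /eqP : a *: B v = 0 by rewrite -linearZ /= -Av -comp_lfunE BA0 zero_lfunE.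
by rewrite scaler_eq0 (negPf a0) /= Av => /eqP ->; rewrite addr0.
Qed.

(** Since AB = 0, A (A v) = A ((A + B) v) = a A v. *)
Lemma leigenspaceD_image V (A B : 'End(V)) a v :
  (A \o B)%VF = 0 -> v \in leigenspace (A + B) a -> A v \in leigenspace A a.
Proof.
move=> AB0; rewrite !mem_leigenspace add_lfunE => /eqP ABv.
rewrite -linearZ /= -ABv linearD /= -[A (B v)]comp_lfunE.
by rewrite AB0 zero_lfunE addr0.
Qed.

(** The component of an eigenvector v of A + B in the a-eigenspace of A is
    a^-1 A v, and likewise for B; for a = 0 the statement fails, as the two
    kernels may share vectors. *)
Lemma leigenspace_add_dim V (A B : 'End(V)) a :
  a != 0 -> (A \o B)%VF = 0 -> (B \o A)%VF = 0 ->
  \dim (leigenspace (A + B) a)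
    = (\dim (leigenspace A a) + \dim (leigenspace B a))%N.
Proof.
move=> a0 AB0 BA0.
have -> : leigenspace (A + B) a = (leigenspace A a + leigenspace B a)%VS.
  apply/eqP; rewrite eqEsubv subv_add leigenspace_subD //.
  rewrite [A + B in X in _ && X]addrC leigenspace_subD // !andbT.
  apply/subvP => v vE; have := vE.
  rewrite mem_leigenspace add_lfunE => /eqP ABv.
  rewrite -[v]scale1r -(mulVf a0) -scalerA -ABv memvZ // memv_add //.
    exact: leigenspaceD_image vE.
  by apply: (leigenspaceD_image (B := A)) => //; rewrite addrC.
rewrite dimv_disjoint_sum //; apply/eqP; rewrite -subv0; apply/subvP => v.
rewrite memv_cap !mem_leigenspace memv0 => /andP[/eqP Av /eqP Bv].
have /eqP : a *: (a *: v) = 0.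
  by rewrite -Av -linearZ /= -Bv -comp_lfunE AB0 zero_lfunE.
by rewrite !scaler_eq0 (negPf a0).
Qed.

End Eigenspaces.

(** * The positive spectrum as a multiset *)

Section SpecPlus.
Variables (R : realType) (U V : vectType R).

Lemma spec_plus_dimE (W : vectType R) (A : 'End(W)) a :
  spec_plus A a = if a == 0 then 0%N else \dim (leigenspace A a).
Proof. by rewrite spec_plusE specE. Qed.

Lemma spec_plus_comp (f : 'Hom(U, V)) (g : 'Hom(V, U)) :
  spec_plus (f \o g)%VF = spec_plus (g \o f)%VF.
Proof.
(* Explicit transitivity steps stand in for rewriting here and in the next
   proof: while looking for its redex, rewriting would try to unify the
   multisets of two different operators by unfolding them. *)
apply/msetP => a; apply: etrans (spec_plus_dimE _ a) _.
apply: etrans _ (esym (spec_plus_dimE _ a)).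
by case: eqVneq => // a0; rewrite leigenspace_comp_dim.
Qed.

Lemma spec_plus_add (A B : 'End(V)) :
  (A \o B)%VF = 0 -> (B \o A)%VF = 0 ->
  spec_plus (A + B) = (spec_plus A `+` spec_plus B)%mset.
Proof.
move=> AB0 BA0; apply/msetP => a; rewrite msetE2.
apply: etrans (spec_plus_dimE _ a) _.
apply: etrans _ (esym (congr2 addn (spec_plus_dimE A a) (spec_plus_dimE B a))).
by case: eqVneq => // a0; exact: leigenspace_add_dim.
Qed.

End SpecPlus.

(** * Orthogonality of the two halves of the Hodge Laplacian *)

Section HodgeOrthogonality.
Variables (R : realType) (Omega : nat -> vectType R).
Variable ip : forall p, inner_product (Omega p).
Variable d : forall p, 'Hom(Omega p.+1, Omega p).
Hypothesis d_d : forall p, (d p \o d p.+1)%VF = 0.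

(** The composition of the adjoints is the adjoint of the composition of the
    boundary maps, which is zero. *)
Lemma adjoint_adjoint0 p :
  (adjoint (ip p.+2) (ip p.+1) (d p.+1) \o adjoint (ip p.+1) (ip p) (d p))%VF
    = 0.
Proof.
apply/lfunP => v; rewrite zero_lfunE comp_lfunE.
apply: (@dot_definite _ _ (ip p.+2)).
by rewrite -!adjointP -[d p _]comp_lfunE d_d zero_lfunE linear0l.
Qed.

Lemma hodge_KL0 p : (hodge_K ip d p \o hodge_L ip d p)%VF = 0.
Proof.
case: p => [|p] /=; first exact: comp_lfun0r.
rewrite /hodge_K /= -comp_lfunA [(adjoint _ _ _ \o _)%VF]comp_lfunA.
by rewrite adjoint_adjoint0 comp_lfun0l comp_lfun0r.
Qed.

Lemma hodge_LK0 p : (hodge_L ip d p \o hodge_K ip d p)%VF = 0.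
Proof.
case: p => [|p] /=; first exact: comp_lfun0l.
rewrite /hodge_K /= -comp_lfunA [(d p \o _)%VF]comp_lfunA.
by rewrite d_d comp_lfun0l comp_lfun0r.
Qed.

End HodgeOrthogonality.

(** * The spectrum of the Hodge Laplacian *)

Theorem proposition3p3 (R : realType) (Omega : nat -> vectType R)
    (ip : forall p : nat, inner_product (Omega p))
    (d : forall p : nat, 'Hom(Omega p.+1, Omega p))
    (d_d : forall p : nat, (d p \o d p.+1)%VF = 0) :
  forall p : nat,
    [/\ spec_plus (hodge_laplacian ip d p)
          = (spec_plus (hodge_K ip d p) `+` spec_plus (hodge_L ip d p))%mset,
        spec_plus (hodge_K ip d p) = spec_plus (hodge_L ip d p.+1)
      & spec_plus (hodge_laplacian ip d p)
          = (spec_plus (hodge_L ip d p) `+` spec_plus (hodge_L ip d p.+1))%mset].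
Proof.
move=> p.
have hK : spec_plus (hodge_K ip d p) = spec_plus (hodge_L ip d p.+1).
  exact: spec_plus_comp.
have hD : spec_plus (hodge_laplacian ip d p)
    = (spec_plus (hodge_K ip d p) `+` spec_plus (hodge_L ip d p))%mset.
  by apply: spec_plus_add; [apply: hodge_KL0 | apply: hodge_LK0].
split; [exact: hD | exact: hK |].
by rewrite hD hK msetDC.
Qed.
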